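(* Let $\mathbb{X}$ be a Polish space, $c:\mathbb{X}\times\mathbb{X}\to\mathbb{R}\cup\{+\infty\}$ a symmetric ground cost, $F$ a Csiszár divergence, and $\varepsilon\in[0,+\infty)$. If $\mathrm{OT}^\varepsilon_c$ is debiasable (as a cost on $\mathcal{P}(\mathbb{X})$), then $\mathrm{UOT}^\varepsilon_{c,F}$ is debiasable (as a cost on $\mathcal{M}_+(\mathbb{X})$).
   Context: A symmetric function $C:\mathcal{X}\times\mathcal{X}\to\mathbb{R}\cup\{+\infty\}$ on a set $\mathcal{X}$ is debiasable if $C(x,y)-\tfrac12C(x,x)-\tfrac12C(y,y)\ge0$ for all $x,y\in\mathcal{X}$, with the rule $\infty-\infty=+\infty$. $\mathcal{P}(\mathbb{X})$: Borel probability measures; $\mathcal{M}_+(\mathbb{X})$: finite nonnegative Borel measures; $\Pi(\mu,\nu)$: couplings of $\mu,\nu$; $p_i$: projection on the $i$-th component. $\mathrm{KL}(\mu|\nu)=\int\log\frac{d\mu}{d\nu}\,d\mu$ if $\mu\ll\nu$, $+\infty$ otherwise. $$\mathrm{OT}^\varepsilon_c(\mu,\nu)=\inf_{\pi\in\Pi(\mu,\nu)}\int c\,d\pi+\varepsilon\,\mathrm{KL}(\pi|\mu\otimes\nu),\quad\mu,\nu\in\mathcal{P}(\mathbb{X}),$$ $$\mathrm{UOT}^\varepsilon_{c,F}(\mu,\nu)=\inf_{\pi\in\mathcal{P}(\mathbb{X}\times\mathbb{X})}\int c\,d\pi+F((p_1)_\#\pi,\mu)+F((p_2)_\#\pi,\nu)+\varepsilon\,\mathrm{KL}(\pi|\mu\otimes\nu),\quad\mu,\nu\in\mathcal{M}_+(\mathbb{X}).$$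 For $\varepsilon=0$ the $\mathrm{KL}$ term is absent. An entropy function is a convex lower semicontinuous $h:[0,+\infty)\to\mathbb{R}\cup\{+\infty\}$ with $h(1)=0$; with $h_\infty=\lim_{r\to+\infty}h(r)/r$, the associated Csiszár divergence is $F(\mu,\nu)=\int h\big(\frac{d\mu}{d\nu}\big)d\nu+h_\infty\int d\mu^\perp$, where $\mu^\perp$ is the singular part in the Lebesgue decomposition of $\mu$ with respect to $\nu$ and $\frac{d\mu}{d\nu}$ the density of the absolutely continuous part. The cost $c$ is Borel measurable and the integrals and infima above are assumed to be well defined in $\mathbb{R}\cup\{+\infty\}$. *)

(* Defs.v *)
From HB Require Import structures.
From mathcomp Require Import all_boot all_order all_algebra.
From mathcomp Require Import all_classical all_reals all_analysis.
From mathcomp Require Import measurable_realfun.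

Set Implicit Arguments.
Unset Strict Implicit.
Unset Printing Implicit Defensive.

Import Order.TTheory GRing.Theory Num.Theory.
Import numFieldNormedType.Exports.

Local Open Scope classical_set_scope.
Local Open Scope ring_scope.
Local Open Scope ereal_scope.
Local Open Scope charge_scope.

Definition is_distance (R : realType) (X : Type) (d : X -> X -> R) : Prop :=
  [/\ forall x y, (0 <= d x y)%R,
      forall x y, d x y = 0%R <-> x = y,
      forall x y, d x y = d y x &
      forall x y z, (d x z <= d x y + d y z)%R].

Definition completely_metrizable (R : realType) (X : topologicalType) : Prop :=
  exists d : X -> X -> R,
    [/\ is_distance d,
        forall x (A : set X), nbhs x A <->
          exists2 e : R, (0 < e)%R & [set y | (d x y < e)%R] `<=` A &
        forall u : nat -> X,
          (forall e : R, (0 < e)%R -> exists N : nat, forall m n : nat,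
             (N <= m)%N -> (N <= n)%N -> (d (u m) (u n) < e)%R) ->
          exists l : X, u @ \oo --> l].

Definition polish (R : realType) (X : topologicalType) : Prop :=
  (exists2 D : set X, countable D & dense D) /\ completely_metrizable R X.

Definition borel (X : ptopologicalType) := g_sigma_algebraType (@open X).

(* On a Polish space the product sigma-algebra carried by
   [borel X * borel X] is the Borel sigma-algebra of the product topology. *)
Lemma measurable_borel_prod (R : realType) (X : ptopologicalType) :
  polish R X ->
  (measurable : set (set (borel X * borel X))) = <<s @open (X * X)%type >>.
Proof.
move=> [[D cD dD] [d [[d0 deq dC dtri] dnbhs _]]].
have oball a (e : R) : open [set y : X | (d a y < e)%R].
  rewrite openE => y /= ye; apply/dnbhs; exists (e - d a y)%R.
    by rewrite subr_gt0.
  move=> z /= yz; apply: le_lt_trans (dtri a y z) _.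
  by rewrite -ltrBrDl.
apply/seteqP; split.
  apply: smallest_sub; first exact: smallest_sigma_algebra.
  pose Y := g_sigma_algebraType (@open (X * X)%type).
  have mfst : measurable_fun [set: Y] (fst : Y -> borel X).
    apply: (@measurability _ _ Y (borel X) _ _ (@open X)) => // _ [A oA <-]; rewrite setTI.
    apply: sub_sigma_algebra; apply: (open_comp _ oA) => z _; exact: cvg_fst.
  have msnd : measurable_fun [set: Y] (snd : Y -> borel X).
    apply: (@measurability _ _ Y (borel X) _ _ (@open X)) => // _ [A oA <-]; rewrite setTI.
    apply: sub_sigma_algebra; apply: (open_comp _ oA) => z _; exact: cvg_snd.
  by move=> _ [] [A mA <-]; [apply: mfst|apply: msnd].
apply: smallest_sub; first exact: (@sigma_algebra_measurable _ (borel X * borel X)%type).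
move=> U oU /=.
pose B (a : X) (q : rat) : set X := [set y | (d a y < ratr q)%R].
pose J := [set i : X * X * rat | [/\ D i.1.1, D i.1.2 &
  B i.1.1 i.2 `*` B i.1.2 i.2 `<=` U]].
have -> : U = \bigcup_(i in J) (B i.1.1 i.2 `*` B i.1.2 i.2).
  apply/seteqP; split; last by move=> z [i [_ _ iU]] /iU.
  move=> [x y] Uxy.
  have [[V W] [/= Vx Wy] VWU] : nbhs (x, y) U by exact: open_nbhs_nbhs.
  move/dnbhs : Vx => [e1 e10 e1V]; move/dnbhs : Wy => [e2 e20 e2W].
  pose e := (Num.min e1 e2 / 2)%R.
  have e0 : (0 < e)%R by rewrite divr_gt0// lt_min e10.
  have [q] := @rat_in_itvoo R _ _ e0; rewrite in_itv/= => /andP[q0 qe].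
  have [a [/= xa Da]] : [set y : X | (d x y < ratr q)%R] `&` D !=set0.
    by apply: dD => //; exists x => /=; rewrite (deq x x).2.
  have [b [/= yb Db]] : [set z : X | (d y z < ratr q)%R] `&` D !=set0.
    by apply: dD => //; exists y => /=; rewrite (deq y y).2.
  have min2 : (ratr q + ratr q < Num.min e1 e2)%R.
    by rewrite [ltRHS](splitr (Num.min e1 e2)) ltrD.
  have [q1 q2] : (ratr q + ratr q < e1 /\ ratr q + ratr q < e2)%R.
    by move: min2; rewrite lt_min => /andP[].
  exists (a, b, q); last by split; rewrite /B /= dC.
  split => // -[x' y'] [/= ax by_]; apply: VWU; split.
    apply: e1V => /=; apply: le_lt_trans (dtri x a x') _.
    by apply: lt_trans q1; rewrite ltrD.
  apply: e2W => /=; apply: le_lt_trans (dtri y b y') _.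
  by apply: lt_trans q2; rewrite ltrD.
rewrite bigcup_set_type; apply: countable_bigcupT_measurable => [|i].
  rewrite (eq_countable (card_setT _)).
  apply: (sub_countable (B := D `*` D `*` [set: rat])).
    by apply: subset_card_le => -[[a b] q] [].
  by apply: countableX => //; exact: countableX.
by apply: measurableX; apply: sub_sigma_algebra; exact: oball.
Qed.

Section divergences.
Context d (T : measurableType d) (R : realType).

Definition KL (mu nu : {finite_measure set T -> \bar R}) : \bar R :=
  if `[< mu `<< nu >] then
    \int[mu]_x lne (('d (charge_of_finite_measure mu) '/d nu) x)
  else +oo.

(* [mu = fs.1 nu + fs.2] with [fs.2] singular with respect to [nu] *)
Definition is_lebesgue_decomposition
    (mu nu : {finite_measure set T -> \bar R})
    (fs : (T -> R) * {measure set T -> \bar R}) : Prop :=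
  [/\ measurable_fun [set: T] fs.1,
      forall x, (0 <= fs.1 x)%R,
      forall A, measurable A ->
        mu A = \int[nu]_(x in A) (fs.1 x)%:E + fs.2 A &
      exists N, [/\ measurable N, nu N = 0 & fs.2 (~` N) = 0]].

Section existence.
Variables mu nu : {finite_measure set T -> \bar R}.

Let l := measure_add mu nu.

HB.instance Definition _ := Measure.on l.

Let finl : fin_num_fun l.
Proof. by move=> A mA; rewrite /l measure_addE fin_numD !fin_num_measure. Qed.

HB.instance Definition _ := @Measure_isFinite.Build _ T _ l finl.

Lemma lebesgue_decomposition_ex : exists fs, is_lebesgue_decomposition mu nu fs.
Proof.
pose L : {finite_measure set T -> \bar R} := l.
have lE A : L A = mu A + nu A by rewrite -measure_addE.
have nul : nu `<< L.
  apply/null_content_dominatesP => A mA; move: (lE A) => + lA0; rewrite lA0 => /esym/eqP.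
  by rewrite padde_eq0 ?measure_ge0// => /andP[_ /eqP].
have [g [g0 gfin ig gE]] := radon_nikodym_sigma_finite nul.
have mg : measurable_fun setT g by exact: measurable_int ig.
pose N := [set x | g x = 0].
have mN : measurable N.
  have -> : N = setT `&` (g @^-1` [set 0]) by rewrite setTI.
  exact: mg.
have nuN : nu N = 0.
  by rewrite gE//; apply: integral0_eq => x.
have mNC : measurable (~` N) by exact: measurableC.
have m1nu : mrestr mu mNC `<< nu.
  apply/null_content_dominatesP => A mA nuA; rewrite /mrestr.
  have mAN : measurable (A `&` ~` N) by exact: measurableI.
  have nuAN : nu (A `&` ~` N) = 0.
    apply/eqP; rewrite eq_le measure_ge0 andbT -nuA.
    by apply: le_measure; rewrite ?inE.
  suff : L (A `&` ~` N) = 0.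
    by rewrite lE => /eqP; rewrite padde_eq0 ?measure_ge0// => /andP[/eqP].
  have : \int[L]_(x in A `&` ~` N) `|g x| = 0.
    by rewrite -nuAN gE//; apply: eq_integral => x _; rewrite gee0_abs.
  move/ae_eq_integral_abs => /(_ mAN (measurable_funTS mg))[M [mM lM NM]].
  apply/eqP; rewrite eq_le measure_ge0 andbT -lM.
  apply: le_measure; rewrite ?inE// => x ANx; apply: NM => /=.
  by move=> /(_ ANx) gx; case: ANx => _; apply.
have [f [f0 ffin intf fE]] := radon_nikodym_sigma_finite m1nu.
exists (fine \o f, (mrestr mu mN : {measure set T -> \bar R})); split => /=.
- apply: measurableT_comp => //; exact: measurable_int intf.
- by move=> x; exact: fine_ge0.
- move=> A mA.
  under eq_integral do rewrite fineK//.
  rewrite -(fE A mA) (measureDI mu mA mN) setDE.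
  by rewrite /= /mrestr.
- by exists N; split => //; rewrite /mrestr setICl measure0.
Qed.

End existence.

Definition lebesgue_decomposition (mu nu : {finite_measure set T -> \bar R}) :
    (T -> R) * {measure set T -> \bar R} :=
  sval (cid (lebesgue_decomposition_ex mu nu)).

(* Only the values of [h] on [0, +oo[ are used. *)
Definition entropy_function (h : R -> \bar R) : Prop :=
  [/\ forall r, (0 <= r)%R -> h r != -oo,
      forall t x y, (0 <= t <= 1)%R -> (0 <= x)%R -> (0 <= y)%R ->
        h (t * x + (1 - t) * y)%R <= t%:E * h x + (1 - t)%:E * h y,
      lower_semicontinuous (h : subspace (`[0%R, +oo[%classic : set R) -> \bar R) &
      h 1%R = 0].

Definition recession (h : R -> \bar R) : \bar R :=
  lim (h r * (r^-1)%:E @[r --> +oo%R]).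

Definition csiszar (h : R -> \bar R)
    (mu nu : {finite_measure set T -> \bar R}) : \bar R :=
  let fs := lebesgue_decomposition mu nu in
  \int[nu]_x h (fs.1 x) + recession h * fs.2 [set: T].

End divergences.

Section transport.
Context d (T : measurableType d) (R : realType).

HB.instance Definition _ :=
  isMeasurableFun.Build _ _ _ _ (fst : T * T -> T) measurable_fst.
HB.instance Definition _ :=
  isMeasurableFun.Build _ _ _ _ (snd : T * T -> T) measurable_snd.

Definition marg1 (pi : probability (T * T)%type R) : probability T R :=
  distribution pi (fst : T * T -> T).
Definition marg2 (pi : probability (T * T)%type R) : probability T R :=
  distribution pi (snd : T * T -> T).

Definition coupling (mu nu : probability T R) :
    set (probability (T * T)%type R) :=
  [set pi | (forall A, measurable A -> marg1 pi A = mu A) /\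
            (forall A, measurable A -> marg2 pi A = nu A)].

Section product.
Variables mu nu : {finite_measure set T -> \bar R}.

(* The library only makes [mu \x nu] a finite measure canonically when [mu]
   and [nu] are (sub)probabilities given as a pair. *)
Definition product_measure : set (T * T) -> \bar R := mu \x nu.

HB.instance Definition _ := Measure.on product_measure.

Let product_measure_fin : fin_num_fun product_measure.
Proof.
move=> A mA; rewrite ge0_fin_numE ?measure_ge0//.
apply: (@le_lt_trans _ _ (product_measure setT)).
  by apply: le_measure; rewrite ?inE//; exact: measurableT.
rewrite -setXTT /product_measure product_measure1E//.
by rewrite lte_mul_pinfty// ?fin_num_measure// ltey_eq fin_num_measure.
Qed.

HB.instance Definition _ :=
  @Measure_isFinite.Build _ _ _ product_measure product_measure_fin.

End product.

(* Since [0 * +oo = 0], the [KL] terms vanish for [eps = 0]. *)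
Definition OT (c : T * T -> \bar R) (eps : R) (mu nu : probability T R) :
    \bar R :=
  ereal_inf [set \int[pi]_z c z + eps%:E * KL pi (product_measure mu nu) |
             pi in coupling mu nu].

Definition UOT (c : T * T -> \bar R)
    (F : {finite_measure set T -> \bar R} ->
         {finite_measure set T -> \bar R} -> \bar R)
    (eps : R) (mu nu : {finite_measure set T -> \bar R}) : \bar R :=
  ereal_inf [set \int[pi]_z c z + F (marg1 pi) mu + F (marg2 pi) nu
                 + eps%:E * KL pi (product_measure mu nu) |
             pi in [set: probability (T * T)%type R]].

End transport.

(* In [%dE], [+oo - +oo = +oo]. *)
Definition debiasable (R : realType) (X : Type) (C : X -> X -> \bar R) : Prop :=
  [/\ forall x y, C x y = C y x,
      forall x y, C x y != -oo &
      forall x y,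
        (0 <= C x y - (2^-1)%:E * C x x - (2^-1)%:E * C y y)%dE].

(* Main.v *)
Require Import Defs.
From HB Require Import structures.
From mathcomp Require Import all_boot all_order all_algebra.
From mathcomp Require Import all_classical all_reals all_analysis.
From mathcomp Require Import measurable_realfun.
From mathcomp Require Import lra.

(** The heart of the matter is the chain rule for the relative entropy
    ([KL_chain]): if [pi] has marginals [al] and [be], then for all finite
    [mu] and [nu]

      KL(pi | mu x nu) = KL(pi | al x be) + KL(al | mu) + KL(be | nu).

    It separates, in the functional minimized by UOT, what depends on the whole
    plan from what depends on its marginals only ([UOT_value_split]):

      UOT(mu, nu) = inf_(al, be) OT(al, be) + G(al, mu) + G(be, nu),

    with G(al, mu) = F(al, mu) + eps KL(al | mu).  The two inequalities are
    [UOT_le_OT] and [UOT_value_ge_OT].  The symmetry of OT passes to UOT through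
    this formula.  For the gap, take any plan of finite value, with marginals
    [al] and [be]; as OT is debiasable,

      OT(al, be) + G(al, mu) + G(be, nu)
        >= 1/2 (OT(al, al) + 2 G(al, mu)) + 1/2 (OT(be, be) + 2 G(be, nu))
        >= 1/2 UOT(mu, mu) + 1/2 UOT(nu, nu),

    since (al, al) and (be, be) are competitors in the formula for UOT(mu, mu)
    and UOT(nu, nu).  It remains to take the infimum over the plans.

    The chain rule follows from log(k f g) = log k + log f + log g for the
    densities k of [pi] with respect to al x be, f of [al] with respect to [mu]
    and g of [be] with respect to [nu].  The logarithms need not be integrable,
    but their negative parts are ([KL_density_funeneg]), and this suffices to
    split the integral ([integralD_funeneg]).  If [pi] is not dominated by
    mu x nu, then one of the three dominations on the right fails, and both
    sides are infinite.

    A coupling has its marginals prescribed on measurable sets only, whereas a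
    measure is a function on all sets: [csiszar_eq_measure] and
    [integral_image] bridge this difference. *)

Set Implicit Arguments.
Unset Strict Implicit.
Unset Printing Implicit Defensive.

Import Order.TTheory GRing.Theory Num.Theory.
Import numFieldNormedType.Exports.

Local Open Scope classical_set_scope.
Local Open Scope ring_scope.
Local Open Scope ereal_scope.
Local Open Scope charge_scope.

(** * Integrals of functions with integrable negative part *)

Lemma sube_decomp (R : realDomainType) (a b p q m n : \bar R) :
  0 <= a -> 0 <= b -> 0 <= p -> 0 <= q -> 0 <= m -> 0 <= n ->
  b < +oo -> m < +oo -> n < +oo -> a + (m + n) = b + (p + q) ->
  a - b = (p - m) + (q - n).
Proof.
move: b m n => [b| |] [m| |] [n| |] //.
move: a p q => [a| |] [p| |] [q| |] // _ _ _ _ _ _ _ _ _ [] e.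
by congr EFin; lra.
Qed.

Section integral_sum.
Context d (T : measurableType d) (R : realType).
Variable mu : {measure set T -> \bar R}.

Lemma integral_funenegD_lty (f g : T -> R) :
  measurable_fun [set: T] f -> measurable_fun [set: T] g ->
  \int[mu]_x (EFin \o f)^\- x < +oo -> \int[mu]_x (EFin \o g)^\- x < +oo ->
  \int[mu]_x (EFin \o (fun x => f x + g x)%R)^\- x < +oo.
Proof.
move=> mf mg nf ng.
have mN (k : T -> R) : measurable_fun [set: T] k ->
    measurable_fun [set: T] (EFin \o k)^\-.
  by move=> mk; apply: measurable_funeneg; exact/measurable_EFinP.
apply: (@le_lt_trans _ _
    (\int[mu]_x ((EFin \o f)^\- x + (EFin \o g)^\- x))); last first.
  by rewrite ge0_integralD//; [exact: lte_add_pinfty|exact: mN..].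
apply: ge0_le_integral => //.
- by apply: mN; exact: measurable_funD.
- by apply: emeasurable_funD; exact: mN.
- move=> x _; rewrite !funenegE /= -!EFin_max -EFinD lee_fin.
  by rewrite /Num.max; do ?case: ifPn; lra.
Qed.

(** Integrability of the negative parts excludes the indeterminate form, so the
    positive parts may have infinite integrals. *)
Lemma integralD_funeneg (f g : T -> R) :
  measurable_fun [set: T] f -> measurable_fun [set: T] g ->
  \int[mu]_x (EFin \o f)^\- x < +oo -> \int[mu]_x (EFin \o g)^\- x < +oo ->
  \int[mu]_x (f x + g x)%:E = \int[mu]_x (f x)%:E + \int[mu]_x (g x)%:E.
Proof.
move=> mf mg nf ng; have nS := integral_funenegD_lty mf mg nf ng.
have mS : measurable_fun [set: T] (fun x => (f x + g x)%R).
  exact: measurable_funD.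
have mP (k : T -> R) : measurable_fun [set: T] k ->
    measurable_fun [set: T] (EFin \o k)^\+.
  by move=> mk; apply: measurable_funepos; exact/measurable_EFinP.
have mN (k : T -> R) : measurable_fun [set: T] k ->
    measurable_fun [set: T] (EFin \o k)^\-.
  by move=> mk; apply: measurable_funeneg; exact/measurable_EFinP.
rewrite [LHS]integralE [X in _ = X + _]integralE [X in _ = _ + X]integralE.
apply: sube_decomp => //; do ?exact: integral_ge0.
rewrite -!ge0_integralD//; do ?[exact: mN|exact: mP]; last 4 first.
- by move=> x _; rewrite adde_ge0.
- by apply: emeasurable_funD; exact: mP.
- by move=> x _; rewrite adde_ge0.
- by apply: emeasurable_funD; exact: mN.
apply: eq_integral => x _.
rewrite !funenegE !funeposE /= -!EFin_max -!EFinD; congr EFin.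
by rewrite /Num.max; do ?case: ifPn; lra.
Qed.

End integral_sum.

(** * Densities and relative entropy *)

Section density.
Context d (T : measurableType d) (R : realType).
Implicit Types mu nu : {finite_measure set T -> \bar R}.

(** Real-valued densities, as a relation: unlike with the Radon-Nikodym
    derivative, products of densities can be exhibited as densities without any
    almost-everywhere argument. *)
Definition is_density mu nu (g : T -> R) : Prop :=
  [/\ measurable_fun [set: T] g, forall x, (0 <= g x)%R &
      forall A, measurable A -> mu A = \int[nu]_(x in A) (g x)%:E].

Lemma density_dominates mu nu g : is_density mu nu g -> mu `<< nu.
Proof.
move=> [mg g0 gE]; apply/null_content_dominatesP => A mA nuA.
rewrite gE//; under eq_integral do rewrite -[(g _)%:E]gee0_abs ?lee_fin//.
apply: integral_abs_eq0 => //.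
by apply: measurable_funTS; exact/measurable_EFinP.
Qed.

Lemma dominates_density mu nu : mu `<< nu -> exists g, is_density mu nu g.
Proof.
move=> munu; have [g [g0 gfin ig gE]] := radon_nikodym_sigma_finite munu.
exists (fine \o g); split => /=.
- by apply: measurableT_comp => //; exact: measurable_int ig.
- by move=> x; exact: fine_ge0.
- by move=> A mA; rewrite gE//; apply: eq_integral => x _; rewrite fineK.
Qed.

Lemma ge0_integral_density mu nu g (phi : T -> \bar R) E : is_density mu nu g ->
  measurable E -> measurable_fun E phi -> (forall x, 0 <= phi x) ->
  \int[mu]_(x in E) phi x = \int[nu]_(x in E) (phi x * (g x)%:E).
Proof.
move=> dg mE mphi phi0; have munu := density_dominates dg.
case: dg => mg g0 gE.
rewrite -(Radon_Nikodym_SigmaFinite.change_of_variables munu)//.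
have fi := Radon_Nikodym_SigmaFinite.f_integrable munu.
apply: ge0_ae_eq_integral => //.
- apply: emeasurable_funM => //.
  exact/measurable_funTS/(measurable_int _ fi).
- by apply: emeasurable_funM => //; exact/measurable_funTS/measurable_EFinP.
- by move=> x _; rewrite mule_ge0// Radon_Nikodym_SigmaFinite.f_ge0.
- by move=> x _; rewrite mule_ge0// lee_fin.
apply: ae_eqe_mul2l; apply: (ae_eq_subset (subsetT E)).
apply: integral_ae_eq => //; first exact/measurable_EFinP.
by move=> A _ mA; rewrite -gE// -Radon_Nikodym_SigmaFinite.f_integral.
Qed.

Lemma density_Radon_Nikodym mu nu g : is_density mu nu g ->
  ae_eq nu [set: T] ('d (charge_of_finite_measure mu) '/d nu)
    (EFin \o g).
Proof.
move=> dg; have munu := density_dominates dg; case: dg => mg g0 gE.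
apply: integral_ae_eq => //.
- exact: Radon_Nikodym_integrable.
- exact/measurable_EFinP.
- by move=> A _ mA; rewrite -Radon_Nikodym_integral// -gE.
Qed.

Lemma measurable_density_eq0 mu nu g : is_density mu nu g ->
  measurable [set x | g x = 0%R].
Proof.
move=> [mg _ _].
have -> : [set x | g x = 0%R] = [set: T] `&` (g @^-1` [set 0%R]).
  by rewrite setTI.
exact: mg.
Qed.

Lemma density_eq0 mu nu g : is_density mu nu g -> mu [set x | g x = 0%R] = 0.
Proof.
move=> dg; have [_ _ ->] := dg; last exact: measurable_density_eq0 dg.
by apply: integral0_eq => x /= ->.
Qed.

Lemma measurable_ln_density mu nu g : is_density mu nu g ->
  measurable_fun [set: T] (fun x => ln (g x)).
Proof.
by move=> [mg _ _]; apply: measurableT_comp => //; exact: measurable_ln.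
Qed.

(** The logarithm [ln] is real-valued, with [ln 0 = 0], whereas [lne 0 = -oo];
    the two integrands differ on a [mu]-null set only ([density_eq0]). *)
Lemma KL_density mu nu g : is_density mu nu g ->
  KL mu nu = \int[mu]_x (ln (g x))%:E.
Proof.
move=> dg; have munu := density_dominates dg.
rewrite /KL asboolT//.
pose RN := 'd (charge_of_finite_measure mu) '/d nu.
have mRN : measurable_fun [set: T] RN.
  by apply: measurable_int; exact: Radon_Nikodym_integrable.
apply: ae_eq_integral => //.
- have -> : (fun x => lne (RN x)) =
      (fun x => if (fine (RN x) <= 0)%R then -oo else (ln (fine (RN x)))%:E).
    apply/funext => x; rewrite -{1}(@fineK _ (RN x))//.
    exact: Radon_Nikodym_fin_num.
  apply: measurable_fun_ifT => //.
    by apply: measurable_fun_ler => //; exact: measurableT_comp.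
  apply/measurable_EFinP; apply: measurableT_comp; first exact: measurable_ln.
  exact: measurableT_comp.
- by apply/measurable_EFinP; exact: measurable_ln_density dg.
have [N [mN N0 subN]] := density_Radon_Nikodym dg.
have m0 : measurable [set x | g x = 0%R].
  exact: measurable_density_eq0 dg.
exists (N `|` [set x | g x = 0%R]); split; first exact: measurableU.
- rewrite measureU0//; last exact: density_eq0 dg.
  by move/null_content_dominatesP : munu; exact.
move=> x /=; apply: contra_notP => /not_orP[Nx gx] _.
rewrite -[X in lne X]/(RN x); have -> : RN x = (g x)%:E.
  by apply: contrapT => H; apply: Nx; apply: subN => /= /(_ I).
rewrite lne_EFin// lt_neqAle eq_sym; case: dg => _ -> _; rewrite andbT.
exact/eqP.
Qed.

(** With respect to [nu] the integrand becomes [g] times the negative part of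
    [ln g], which is at most 1, because [- ln g = ln g^-1 <= g^-1]. *)
Lemma KL_density_funeneg mu nu g : is_density mu nu g ->
  \int[mu]_x (EFin \o (fun x => ln (g x)))^\- x < +oo.
Proof.
move=> dg; have ml := measurable_ln_density dg.
have mn : measurable_fun [set: T] (EFin \o (fun x => ln (g x)))^\-.
  by apply: measurable_funeneg; exact/measurable_EFinP.
rewrite (ge0_integral_density dg)//.
apply: (@le_lt_trans _ _ (\int[nu]_x 1)); last first.
  by rewrite integral_cst// mul1e ltey_eq fin_num_measure.
case: dg => mg g0 _; apply: ge0_le_integral => //.
- by move=> x _; rewrite mule_ge0// lee_fin.
- by apply: emeasurable_funM => //; exact/measurable_EFinP.
move=> x _; rewrite funenegE /= -EFin_max -EFinM lee_fin.
have [->|gx0] := eqVneq (g x) 0%R; first by rewrite mulr0.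
have gx : (0 < g x)%R by rewrite lt_neqAle eq_sym gx0 g0.
rewrite -ler_pdivlMr// mul1r ge_max invr_ge0 g0 andbT -lnV//.
by rewrite ltW// ln_sublinear// invr_gt0.
Qed.

Lemma KL_gtNy mu nu : KL mu nu != -oo.
Proof.
have [/dominates_density[g dg]|nd] := pselect (mu `<< nu); last first.
  by rewrite /KL asboolF.
rewrite (KL_density dg) integralE.
have := KL_density_funeneg dg.
set A := integral _ _ _; set B := integral _ _ _.
have A0 : 0 <= A by exact: integral_ge0.
have B0 : 0 <= B by exact: integral_ge0.
rewrite -/B.
by move: A B A0 B0 => [a| |] [b| |].
Qed.
End density.

(** For an arbitrary measurable [phi]: the identity holds for the positive and
    negative parts, whose difference defines the integral. *)
Lemma integral_image d1 d2 (T1 : measurableType d1) (T2 : measurableType d2)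
    (R : realType) (pi : {measure set T1 -> \bar R})
    (al : {measure set T2 -> \bar R}) (p : T1 -> T2) (phi : T2 -> \bar R) :
  measurable_fun [set: T1] p ->
  (forall A, measurable A -> pi (p @^-1` A) = al A) ->
  measurable_fun [set: T2] phi ->
  \int[al]_x phi x = \int[pi]_z phi (p z).
Proof.
move=> mp pal mphi.
have ge0E (h : T2 -> \bar R) : measurable_fun [set: T2] h ->
    (forall x, 0 <= h x) -> \int[al]_x h x = \int[pi]_z h (p z).
  move=> mh h0.
  rewrite -[RHS](@ge0_integral_pushforward _ _ _ _ _ _ mp _ setT)//.
  by apply: eq_measure_integral => A mA _; rewrite -pal.
have mp' := measurable_funepos mphi; have mn' := measurable_funeneg mphi.
rewrite integralE [RHS]integralE (ge0E _ mp')// (ge0E _ mn')//.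
by congr (_ - _); apply: eq_integral => z _; rewrite ?funeposE ?funenegE.
Qed.

Section density_composition.
Context d (T : measurableType d) (R : realType).
Implicit Types mu nu la : {finite_measure set T -> \bar R}.

Lemma density_trans mu nu la f g : is_density mu nu f -> is_density nu la g ->
  is_density mu la (f \* g)%R.
Proof.
move=> [mf f0 fE] dg; have [mg g0 gE] := dg; split.
- exact: measurable_funM.
- by move=> x; rewrite mulr_ge0.
- move=> A mA; rewrite fE// (ge0_integral_density dg)//.
  exact/measurable_funTS/measurable_EFinP.
Qed.

Lemma density_null_support mu nu g A : is_density mu nu g -> measurable A ->
  mu A = 0 -> nu (A `&` [set x | g x != 0%R]) = 0.
Proof.
move=> dg mA muA0; have [mg g0 gE] := dg.
have mEg : measurable_fun A (EFin \o g).
  exact/measurable_funTS/measurable_EFinP.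
have : \int[nu]_(x in A) `|(EFin \o g) x| = 0.
  rewrite -muA0 gE//; apply: eq_integral => x _.
  by rewrite gee0_abs// lee_fin.
move/(ae_eq_integral_abs _ mA mEg) => [M [mM M0 subM]].
have m0 : measurable [set x | g x != 0%R].
  have -> : [set x | g x != 0%R] = ~` [set x | g x = 0%R].
    by apply/seteqP; split => x /= /eqP.
  by apply: measurableC; exact: measurable_density_eq0 dg.
apply: (subset_measure0 _ mM _ M0); first exact: measurableI.
by move=> x [Ax /= /eqP gx]; apply: subM => /= /(_ Ax) [].
Qed.

End density_composition.

(** * Chain rule for the relative entropy *)

Section chain_rule.
Context d (T : measurableType d) (R : realType).
Implicit Types mu nu al be : {finite_measure set T -> \bar R}.

(** By Tonelli's theorem, after expressing the inner and the outer integral of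
    the product measure through the densities. *)
Lemma density_product al be mu nu f g :
  is_density al mu f -> is_density be nu g ->
  is_density (product_measure al be) (product_measure mu nu)
    (fun z => f z.1 * g z.2)%R.
Proof.
move=> df dg; have [mf f0 fE] := df; have [mg g0 gE] := dg.
have mfg : measurable_fun [set: T * T] (fun z : T * T => (f z.1 * g z.2)%R).
  by apply: measurable_funM; exact: measurableT_comp.
split => //; first by move=> z; rewrite mulr_ge0.
move=> A mA.
have mh : measurable_fun [set: T * T]
    (fun z : T * T => (f z.1 * g z.2)%:E * (\1_A z)%:E).
  by apply: emeasurable_funM; apply/measurable_EFinP.
have h0 (z : T * T) : 0 <= (f z.1 * g z.2)%:E * (\1_A z)%:E.
  by rewrite mule_ge0// lee_fin ?mulr_ge0.
rewrite integral_mkcond.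
transitivity (\int[product_measure mu nu]_z
    ((f z.1 * g z.2)%:E * (\1_A z)%:E)); last first.
  by apply: eq_integral => z _; rewrite epatch_indic.
rewrite [RHS](@fubini_tonelli1 _ _ _ _ _ mu nu _ mh h0).
rewrite [LHS](ge0_integral_density df)//; last exact: measurable_fun_xsection.
apply: eq_integral => x _ /=; rewrite /fubini_F /=.
have mx : measurable (xsection A x) by exact: measurable_xsection.
rewrite gE// integral_mkcond.
under [RHS]eq_integral do rewrite EFinM -muleA.
rewrite ge0_integralZl//; last 3 first.
- apply: emeasurable_funM; first exact/measurable_EFinP.
  by apply/measurable_EFinP; apply: measurableT_comp.
- by move=> y _; rewrite mule_ge0// lee_fin.
- by rewrite lee_fin.
rewrite muleC; congr (_ * _); apply: eq_integral => y _.
rewrite epatch_indic; congr (_ * (_)%:E).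
by rewrite !indicE mem_xsection.
Qed.

Variables (pi : {finite_measure set (T * T)%type -> \bar R})
  (al be : {finite_measure set T -> \bar R}).
Hypothesis pi1 : forall A, measurable A -> pi (fst @^-1` A) = al A.
Hypothesis pi2 : forall A, measurable A -> pi (snd @^-1` A) = be A.

Lemma marginals_dominated mu nu : pi `<< product_measure mu nu ->
  al `<< mu /\ be `<< nu.
Proof.
move/null_content_dominatesP => pid.
split; apply/null_content_dominatesP => A mA A0.
- rewrite -pi1//; apply: pid.
    by rewrite -[X in measurable X]setTI; exact: measurable_fst.
  have -> : fst @^-1` A = A `*` [set: T] by apply/seteqP; split => z //= [].
  by rewrite [LHS]product_measure1E// A0 mul0e.
- rewrite -pi2//; apply: pid.
    by rewrite -[X in measurable X]setTI; exact: measurable_snd.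
  have -> : snd @^-1` A = [set: T] `*` A by apply/seteqP; split => z //= [].
  by rewrite [LHS]product_measure1E// A0 mule0.
Qed.

(** Write [f] and [g] for the densities of the marginals.  A set that is null
    for the product of the marginals is null for [mu x nu] where [f g] does not
    vanish, hence null for [pi] there; and [pi] does not charge the zeros of
    [f g], because its marginals do not charge those of [f] and [g]. *)
Lemma dominated_by_marginals mu nu : pi `<< product_measure mu nu ->
  pi `<< product_measure al be.
Proof.
move=> pid; have [/dominates_density[f df] /dominates_density[g dg]] :=
  marginals_dominated pid.
move/null_content_dominatesP : pid => pid.
apply/null_content_dominatesP => A mA A0.
have zf := measurable_density_eq0 df; have zg := measurable_density_eq0 dg.
pose Z1 : set (T * T) := fst @^-1` [set x | f x = 0%R].
pose Z2 : set (T * T) := snd @^-1` [set x | g x = 0%R].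
have z1 : measurable Z1.
  by rewrite -[X in measurable X]setTI; exact: measurable_fst.
have z2 : measurable Z2.
  by rewrite -[X in measurable X]setTI; exact: measurable_snd.
have p1 : pi Z1 = 0 by rewrite pi1// (density_eq0 df).
have p2 : pi Z2 = 0 by rewrite pi2// (density_eq0 dg).
have dfg := density_product df dg.
pose S := [set z : T * T | (f z.1 * g z.2)%R != 0%R].
have mS : measurable S.
  have -> : S = ~` (Z1 `|` Z2).
    apply/seteqP; split => z /=; rewrite /S /= mulf_eq0.
      by move=> /norP[/eqP ? /eqP ?] [].
    by move=> /not_orP[/eqP fz /eqP gz]; apply/norP.
  by apply: measurableC; exact: measurableU.
have mAS : measurable (A `&` S) by exact: measurableI.
have pAS : pi (A `&` S) = 0.
  by apply: pid; [exact: mAS|exact: (density_null_support dfg mA A0)].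
apply: (@subset_measure0 _ _ _ pi _ ((A `&` S) `|` (Z1 `|` Z2))) => //.
- by apply: measurableU => //; exact: measurableU.
- move=> z Az; have [fgz|] := eqVneq (f z.1 * g z.2)%R 0%R; last by left.
  by right; move/eqP : fgz; rewrite mulf_eq0 => /orP[/eqP|/eqP]; [left|right].
have p12 := etrans (measureU0 z1 z2 p2) p1.
exact: etrans (measureU0 mAS (measurableU _ _ z1 z2) p12) pAS.
Qed.

(** No relative entropy is [-oo] ([KL_gtNy]), so a single infinite term makes the
    right-hand side infinite; this settles the case where [pi] is not dominated
    by mu x nu. *)
Lemma KL_chain mu nu : KL pi (product_measure mu nu) =
  KL pi (product_measure al be) + (KL al mu + KL be nu).
Proof.
have [pid|npid] := pselect (pi `<< product_measure mu nu); last first.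
  rewrite {1}/KL asboolF//.
  suff : [\/ KL pi (product_measure al be) = +oo, KL al mu = +oo |
              KL be nu = +oo].
    have := KL_gtNy be nu; have := KL_gtNy al mu.
    have := KL_gtNy pi (product_measure al be).
    by move: (KL _ _) (KL _ _) (KL _ _) => [a| |] [b| |] [c| |]// _ _ _ [].
  have [/dominates_density[f df]|n1] := pselect (al `<< mu); last first.
    by apply: Or32; rewrite /KL asboolF.
  have [/dominates_density[g dg]|n2] := pselect (be `<< nu); last first.
    by apply: Or33; rewrite /KL asboolF.
  apply: Or31; rewrite /KL asboolF// => piab; apply: npid.
  apply: null_dominates_trans piab _.
  exact: density_dominates (density_product df dg).
have [/dominates_density[f df] /dominates_density[g dg]] :=
  marginals_dominated pid.
have [k dk] := dominates_density (dominated_by_marginals pid).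
have dfg := density_product df dg.
have dp := density_trans dk dfg.
rewrite (KL_density dp) (KL_density dk) (KL_density df) (KL_density dg).
have lf := measurable_ln_density df; have lg := measurable_ln_density dg.
have lk := measurable_ln_density dk; have lp := measurable_ln_density dp.
have mlf : measurable_fun [set: T] (fun x => (ln (f x))%:E).
  exact/measurable_EFinP.
have mlg : measurable_fun [set: T] (fun x => (ln (g x))%:E).
  exact/measurable_EFinP.
have lf1 : measurable_fun [set: T * T] (fun z => ln (f z.1)).
  exact: (measurableT_comp lf measurable_fst).
have lg2 : measurable_fun [set: T * T] (fun z => ln (g z.2)).
  exact: (measurableT_comp lg measurable_snd).
have nf : \int[pi]_z (EFin \o (fun z : T * T => ln (f z.1)))^\- z < +oo.
  rewrite [X in X < _](_ : _ = \int[al]_x (EFin \o (fun x => ln (f x)))^\- x).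
    exact: KL_density_funeneg df.
  rewrite (integral_image measurable_fst pi1 (measurable_funeneg mlf)).
  by apply: eq_integral => z _; rewrite !funenegE.
have ng : \int[pi]_z (EFin \o (fun z : T * T => ln (g z.2)))^\- z < +oo.
  rewrite [X in X < _](_ : _ = \int[be]_x (EFin \o (fun x => ln (g x)))^\- x).
    exact: KL_density_funeneg dg.
  rewrite (integral_image measurable_snd pi2 (measurable_funeneg mlg)).
  by apply: eq_integral => z _; rewrite !funenegE.
rewrite (integral_image measurable_fst pi1 mlf).
rewrite (integral_image measurable_snd pi2 mlg).
rewrite -(integralD_funeneg lf1 lg2)// -integralD_funeneg//; last 3 first.
- exact: measurable_funD.
- exact: KL_density_funeneg dk.
- exact: integral_funenegD_lty.
apply: ae_eq_integral => //; first exact/measurable_EFinP.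
  apply/measurable_EFinP; apply: measurable_funD => //.
  exact: measurable_funD.
(* [ln] is additive on positive reals, and [pi] does not charge the zeros of its
   own density k f g. *)
exists [set z | (k z * (f z.1 * g z.2) = 0)%R]; split.
- exact: measurable_density_eq0 dp.
- exact: density_eq0 dp.
move=> z /=; apply: contra_notP => /eqP; rewrite !mulf_eq0.
move=> /norP[k0 /norP[f0 g0]] _.
have pos (u : R) : (0 <= u)%R -> u != 0%R -> u \is Num.pos.
  by move=> u0 uN0; rewrite posrE lt_neqAle eq_sym uN0.
have kp : k z \is Num.pos by apply: pos => //; case: dk.
have fp : f z.1 \is Num.pos by apply: pos => //; case: df.
have gp : g z.2 \is Num.pos by apply: pos => //; case: dg.
by rewrite !lnM// posrE mulr_gt0.
Qed.
End chain_rule.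

(** * Dependence of the divergence on measurable sets only *)

Section csiszar_ext.
Context d (T : measurableType d) (R : realType).

(** The Lebesgue decomposition is chosen among the pairs satisfying a predicate;
    measures that agree on measurable sets define the same predicate, hence lead
    to the same choice. *)
Lemma csiszar_eq_measure (h : R -> \bar R)
    (mu mu' nu : {finite_measure set T -> \bar R}) :
  (forall A, measurable A -> mu A = mu' A) ->
  csiszar h mu nu = csiszar h mu' nu.
Proof.
move=> mumu'; rewrite /csiszar.
suff -> : lebesgue_decomposition mu nu = lebesgue_decomposition mu' nu by [].
have cid_ext (U : Type) (P Q : U -> Prop) (p : exists x, P x)
    (q : exists x, Q x) : P = Q -> sval (cid p) = sval (cid q).
  move=> PQ; rewrite PQ in p *; congr (sval (cid _)).
  exact: Prop_irrelevance.
apply: cid_ext; apply/funext => fs; apply/propext.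
split=> -[mf f0 fE sing]; split => // A mA.
- by rewrite -mumu'// fE.
- by rewrite mumu'// fE.
Qed.
End csiszar_ext.

(** * From optimal transport to unbalanced optimal transport *)

(** The convention [+oo - +oo = +oo] makes the gap nonnegative when [a = +oo];
    when [a] is finite, it forces [b] and [c] to be finite. *)
Lemma debias_gap_ge0 (R : realType) (a b c : \bar R) :
  a != -oo -> b != -oo -> c != -oo ->
  (0 <= a - (2^-1)%:E * b - (2^-1)%:E * c)%dE <->
  (a < +oo -> exists b' c' : R,
     [/\ b = b'%:E, c = c'%:E & (2^-1 * b' + 2^-1 * c')%:E <= a]).
Proof.
have h0 : 0 < (2^-1 : R)%:E by rewrite lte_fin invr_gt0.
rewrite !DualAddTheoryNumDomain.dual_addeE !oppeK oppe_ge0.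
move: a b c => [a| |] [b| |] [c| |] // _ _ _; rewrite ?(gt0_muley h0)//;
  split=> //=.
- move=> H _; exists b, c; split => //; move: H.
  rewrite -?EFinM -?EFinN -?EFinD !lee_fin; lra.
- move=> /(_ (ltry _))[b' [c' [[->] [->]]]].
  rewrite -?EFinM -?EFinN -?EFinD !lee_fin; lra.
- by move=> /(_ (ltry _))[b' [c' []]].
- by move=> /(_ (ltry _))[b' [c' []]].
- by move=> /(_ (ltry _))[b' [c' []]].
all: by move=> _; rewrite !addNye leNye.
Qed.

Section unbalanced.
Context d (T : measurableType d) (R : realType).
Variables (c : T * T -> \bar R) (h : R -> \bar R) (eps : R).
Hypothesis UOT_Ny : forall mu nu : {finite_measure set T -> \bar R},
  UOT c (csiszar h) eps mu nu != -oo.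
Implicit Types mu nu : {finite_measure set T -> \bar R}.
Implicit Types al be : probability T R.
Implicit Types pi : probability (T * T)%type R.

Definition marginal_penalty (al mu : {finite_measure set T -> \bar R}) :
    \bar R :=
  csiszar h al mu + eps%:E * KL al mu.

Definition OT_value al be pi : \bar R :=
  \int[pi]_z c z + eps%:E * KL pi (product_measure al be).

Definition UOT_value mu nu pi : \bar R :=
  \int[pi]_z c z + csiszar h (marg1 pi) mu + csiszar h (marg2 pi) nu
  + eps%:E * KL pi (product_measure mu nu).

(** The chain rule, multiplied by [eps]; if [eps = 0], all entropic terms
    vanish. *)
Lemma UOT_value_split mu nu al be pi : coupling al be pi ->
  UOT_value mu nu pi =
  OT_value al be pi + (marginal_penalty al mu + marginal_penalty be nu).
Proof.
move=> [pi1 pi2].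
rewrite /UOT_value /OT_value /marginal_penalty.
rewrite (KL_chain pi1 pi2).
rewrite (csiszar_eq_measure h mu (mu' := al) pi1).
rewrite (csiszar_eq_measure h nu (mu' := be) pi2).
have Nadd (x y : \bar R) : x != -oo -> y != -oo -> x +? y.
  by move: x y => [x| |] [y| |].
have NyD (x y : \bar R) : x != -oo -> y != -oo -> x + y != -oo.
  by move: x y => [x| |] [y| |].
have N1 := KL_gtNy al mu; have N2 := KL_gtNy be nu.
have N := KL_gtNy pi (product_measure al be).
rewrite muleDr//; last by apply: Nadd => //; exact: NyD.
rewrite muleDr//; last exact: Nadd.
by rewrite -(addeA (integral _ _ _)) addeACA (addeACA (csiszar _ _ _)).
Qed.

Lemma coupling_marginals pi : coupling (marg1 pi) (marg2 pi) pi.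
Proof. by split. Qed.

Lemma UOT_le_value mu nu pi : UOT c (csiszar h) eps mu nu <= UOT_value mu nu pi.
Proof. by apply: ereal_inf_lbound; exists pi. Qed.

Lemma UOT_le_OT mu nu al be :
  marginal_penalty al mu \is a fin_num ->
  marginal_penalty be nu \is a fin_num ->
  UOT c (csiszar h) eps mu nu <=
  OT c eps al be + (marginal_penalty al mu + marginal_penalty be nu).
Proof.
move=> pal pbe.
have pfin : marginal_penalty al mu + marginal_penalty be nu \is a fin_num.
  by rewrite fin_numD pal pbe.
rewrite -leeBlDr//; apply: le_ereal_inf_tmp => _ [pi picpl <-].
by rewrite leeBlDr// -[X in _ <= X + _]/(OT_value al be pi)
  -(UOT_value_split _ _ picpl) UOT_le_value.
Qed.

(** The pair [al], [be] is that of the marginals of [pi].  The value is not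
    [-oo], as it is bounded below by UOT, and a finite sum has finite terms;
    thus the penalties are finite and can be moved across inequalities. *)
Lemma UOT_value_ge_OT mu nu pi : UOT_value mu nu pi < +oo ->
  exists al be,
  [/\ marginal_penalty al mu \is a fin_num,
      marginal_penalty be nu \is a fin_num,
      OT c eps al be < +oo &
      OT c eps al be + (marginal_penalty al mu + marginal_penalty be nu) <=
      UOT_value mu nu pi].
Proof.
move=> vy; exists (marg1 pi), (marg2 pi).
have : UOT_value mu nu pi \is a fin_num.
  rewrite fin_numElt vy andbT ltNye; apply: contra_neq (UOT_Ny mu nu) => vNy.
  by apply/eqP; rewrite -leeNy_eq -vNy UOT_le_value.
have cpl := coupling_marginals pi.
have OTle : OT c eps (marg1 pi) (marg2 pi) <= OT_value (marg1 pi) (marg2 pi) pi.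
  by apply: ereal_inf_lbound; exists pi.
rewrite (UOT_value_split mu nu cpl) fin_numD [X in _ && X]fin_numD.
move=> /and3P[vfin pfin1 pfin2].
split=> //; last by rewrite leeD2r.
by apply: le_lt_trans OTle _; rewrite ltey_eq vfin.
Qed.

Lemma UOT_sym_le mu nu : (forall al be, OT c eps al be = OT c eps be al) ->
  UOT c (csiszar h) eps nu mu <= UOT c (csiszar h) eps mu nu.
Proof.
move=> OTsym; apply: le_ereal_inf_tmp => _ [pi _ <-].
rewrite -[leRHS]/(UOT_value mu nu pi).
have [->|] := eqVneq (UOT_value mu nu pi) +oo; first exact: leey.
rewrite -ltey => /UOT_value_ge_OT[al [be [f1 f2 _]]]; apply: le_trans.
by rewrite OTsym (addeC (marginal_penalty al mu)) UOT_le_OT.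
Qed.

Lemma debiasable_UOT :
  debiasable (OT c eps) -> debiasable (UOT c (csiszar h) eps).
Proof.
move=> [OTsym OTNy OTgap]; split.
- move=> mu nu; apply: le_anti; apply/andP.
  by split; apply: UOT_sym_le.
- exact: UOT_Ny.
move=> mu nu; apply/(debias_gap_ge0 (UOT_Ny _ _) (UOT_Ny _ _) (UOT_Ny _ _)).
have key pi : UOT_value mu nu pi < +oo -> exists b' c' : R,
   [/\ UOT c (csiszar h) eps mu mu = b'%:E,
       UOT c (csiszar h) eps nu nu = c'%:E &
       (2^-1 * b' + 2^-1 * c')%:E <= UOT_value mu nu pi].
  move=> /UOT_value_ge_OT[al [be [f1 f2 OTy]]].
  have [a [b [OTa OTb]]] := (debias_gap_ge0 (OTNy _ _) (OTNy _ _) (OTNy _ _)).1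
    (OTgap al be) OTy.
  (* The diagonal pairs [(al, al)] and [(be, be)] bound UOT on the diagonal. *)
  have := UOT_le_OT f2 f2; have := UOT_le_OT f1 f1; rewrite OTa OTb.
  move: f1 f2 OTy (OTNy al be) (UOT_Ny mu mu) (UOT_Ny nu nu).
  move: (marginal_penalty al mu) (marginal_penalty be nu).
  move=> [p| |]// [q| |]// _ _.
  move: (OT _ _ al be) => [t| |]// _ _.
  move: (UOT _ _ _ mu mu) (UOT _ _ _ nu nu) => [m| |]// [n| |]// _ _.
  rewrite -!EFinD !lee_fin => h1 h2 h3 h4; exists m, n; split => //.
  by apply: le_trans h4; rewrite lee_fin; lra.
move=> UOTy; have [_ [pi _ <-] /key[b' [c' [mE nE _]]]] := ereal_inf_lt UOTy.
exists b', c'; split => //; apply: le_ereal_inf_tmp => _ [pi' _ <-].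
rewrite -[leRHS]/(UOT_value mu nu pi').
have [->|] := eqVneq (UOT_value mu nu pi') +oo; first exact: leey.
by rewrite -ltey => /key[b'' [c'' []]]; rewrite mE nE => -[<-] [<-].
Qed.

End unbalanced.

Theorem lemma3p1 (R : realType) (X : ptopologicalType)
    (polishX : polish R X)
    (c : borel X * borel X -> \bar R)
    (c_meas : measurable_fun [set: borel X * borel X] c)
    (c_Ny : forall z, c z != -oo)
    (c_sym : forall x y, c (x, y) = c (y, x))
    (h : R -> \bar R) (h_entropy : entropy_function h)
    (eps : R) (eps_ge0 : (0 <= eps)%R)
    (int_c : forall pi : probability (borel X * borel X)%type R,
       \int[pi]_z (c^\- z) < +oo)
    (OT_Ny : forall mu nu : probability (borel X) R, OT c eps mu nu != -oo)
    (UOT_Ny : forall mu nu : {finite_measure set (borel X) -> \bar R},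
       UOT c (csiszar h) eps mu nu != -oo) :
  debiasable (OT c eps) ->
  debiasable (UOT c (csiszar h) eps).
Proof.
exact: debiasable_UOT.
Qed.
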